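(* For every integer $k\ge 3$ and every $n\in\{4,5,6\}$, there exists a convex lattice $n$-gon $P$ with $B(P)=n$ and $I(P)=k$ such that the $k$ interior lattice points of $P$ are not collinear (i.e. do not all lie on one line).
   Context: A lattice point is an element of $\mathbb{Z}^2$. A lattice polygon is a simple polygon in $\mathbb{R}^2$ whose vertices are lattice points; an $n$-gon is a polygon with exactly $n$ vertices. A lattice polygon is convex if all its interior angles (at its vertices) are strictly less than $\pi$. $B(P)$ is the number of lattice points on the boundary of $P$ and $I(P)$ is the number of lattice points in the interior of $P$. Thus $B(P)=n$ for an $n$-gon means that the only boundary lattice points are the vertices. *)

(* Defs.v *)
From HB Require Import structures.
From mathcomp Require Export all_boot all_order all_algebra.
From mathcomp Require Export all_classical all_reals all_analysis.
Export Order.TTheory GRing.Theory Num.Theory.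
Export numFieldNormedType.Exports.

Set Implicit Arguments.
Unset Strict Implicit.
Unset Printing Implicit Defensive.

Local Open Scope classical_set_scope.
Local Open Scope ring_scope.

(* [R^o] is [R] as a module over itself, so that the plane has its vector-space
   structure; the norm of the product is the sup norm. *)
Notation plane R := (R^o * R^o)%type.

Definition lattice_points (R : realType) : set (plane R) :=
  [set p | exists a b : int, p = (a%:~R, b%:~R)].

Definition segment (R : realType) (a b : plane R) : set (plane R) :=
  [set (1 - t) *: a + t *: b | t in `[0 : R, 1]].

Definition collinear (R : realType) (A : set (plane R)) : Prop :=
  exists p d : plane R, d != 0 /\ A `<=` range (fun t : R => p + t *: d).

(* A closed polygonal chain with [n] vertices is given by the vertices in cyclic
   order; [ordS] is the cyclic successor on ['I_n]. *)
Section Polygon.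
Variables (R : realType) (n : nat) (P : 'I_n -> plane R).

Definition edge (i : 'I_n) : set (plane R) := segment (P i) (P (ordS i)).

Definition simple_polygon : Prop :=
  [/\ (3 <= n)%N, injective P &
   forall i j : 'I_n, i != j ->
     edge i `&` edge j =
       (if j == ordS i then [set P j]
        else if i == ordS j then [set P i]
        else set0)].

Definition lattice_polygon : Prop :=
  simple_polygon /\ forall i, lattice_points (P i).

Definition poly_boundary : set (plane R) := \bigcup_i edge i.

(* The union of the bounded components of the complement of the boundary.
   [connected_component A x] is empty when [x] is not in [A], hence the explicit
   condition that [x] is not on the boundary. *)
Definition poly_interior : set (plane R) :=
  [set x | ~ poly_boundary x /\
           bounded_set (connected_component (~` poly_boundary) x)].

(* [theta] is the interior angle at [P i]: near [P i], the interior of the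
   polygon is an open circular sector of opening [theta], whose first side, in
   counterclockwise order, has direction [alpha]. *)
Definition interior_angle (i : 'I_n) (theta : R) : Prop :=
  0 < theta < 2 * pi /\
  exists (alpha e : R), 0 < e /\
    forall r phi : R, 0 < r < e -> 0 <= phi < 2 * pi ->
      poly_interior (P i + r *: ((cos (alpha + phi), sin (alpha + phi)) : plane R))
      <-> 0 < phi < theta.

Definition convex_polygon : Prop :=
  forall i, exists2 theta : R, interior_angle i theta & theta < pi.

Definition boundary_lattice_points : set (plane R) :=
  @lattice_points R `&` poly_boundary.

Definition interior_lattice_points : set (plane R) :=
  @lattice_points R `&` poly_interior.

End Polygon.

(* Main.v *)
Require Import Defs.
From mathcomp Require Import zify ring lra.

Set Implicit Arguments.
Unset Strict Implicit.
Unset Printing Implicit Defensive.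

Local Open Scope classical_set_scope.
Local Open Scope card_scope.
Local Open Scope ring_scope.

(** Fix [q = k./2] and [p = k - q]; then [q <= p <= q + 1] and [p + q = k].
    Consider the hexagon with vertices, counterclockwise,
      (2p - q, 0), (q + 1, 2), (1, 3), (0, 2), (0, 1), (2p - q - 1, 0).
    It lies in the strip between the heights 0 and 3.  At height 1 it runs from
    the vertex (0, 1) to (p + 1/2, 1), at height 2 from the vertex (0, 2) to
    the vertex (q + 1, 2).  Its interior lattice points are therefore the [p]
    points (1, 1), ..., (p, 1) and the [q] points (1, 2), ..., (q, 2), which
    are [k] points on two different lines.  Removing the vertex
    (2p - q - 1, 0) cuts off a triangle without lattice points other than its
    vertices, and so does removing (0, 2) afterwards.  This gives the pentagon
    and the quadrilateral, with the same interior lattice points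
    ([family_interior]).

    The rest is a general fact about a cyclic sequence of points such that
    every side has all the other points strictly on its left.  Such a sequence
    bounds a simple polygon ([strictly_convex_simple]), whose interior, in the
    topological sense of bounded complementary components, is the intersection
    [left_region] of the open half-planes to the left of the sides
    ([poly_interiorE]), and whose interior angles are less than [pi]
    ([strictly_convex_angles]).

    For the interior, the key point is that a point on the closed left of all
    sides and on the line of one of them is on that side ([edge_side0]).  Hence
    off the boundary the open and the closed half-planes cut out the same set,
    which is clopen there, and a component that meets it stays inside; it is
    bounded because the sum of the signed areas spanned with the sides does not
    depend on the point.  A point strictly to the right of some side escapes to
    infinity, perpendicularly to this side, without meeting the polygon.

    An edge whose coordinate differences are coprime has no lattice points
    besides its ends ([primitive_segment]), so that only the vertices are
    lattice points of the boundary. *)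

(** * Orientation *)

(** Twice the signed area of the triangle [a b x]: positive when [x] is strictly
    to the left of the line from [a] to [b].  It is used both for the real plane
    and for integer coordinates. *)
Definition orient (A : comPzRingType) (a b x : A * A) : A :=
  (b.1 - a.1) * (x.2 - a.2) - (b.2 - a.2) * (x.1 - a.1).

Definition strictly_convex (A : realDomainType) n (P : 'I_n -> A * A) : Prop :=
  forall i j, j != i -> j != ordS i -> 0 < orient (P i) (P (ordS i)) (P j).

Lemma orient_left (A : comPzRingType) (a b : A * A) : orient a b a = 0.
Proof. by rewrite /orient !subrr !mulr0 subrr. Qed.

Lemma orient_right (A : comPzRingType) (a b : A * A) : orient a b b = 0.
Proof. by rewrite /orient mulrC subrr. Qed.

Lemma orient_rot (A : comPzRingType) (a b c : A * A) :
  orient a b c = orient c a b.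
Proof. rewrite /orient; ring. Qed.

Section Orient.
Variable R : realType.
Implicit Types a b c x y : plane R.
Local Notation orient := (@orient R).

Lemma orient_conv a b x y (t : R) :
  orient a b ((1 - t) *: x + t *: y) = (1 - t) * orient a b x + t * orient a b y.
Proof.
case: x y => [x1 x2] [y1 y2]; rewrite /orient /=.
rewrite /GRing.scale /=; ring.
Qed.

Lemma orient_shift a b x y (s : R) :
  orient a b (x + s *: y) =
  orient a b x + s * ((b.1 - a.1) * y.2 - (b.2 - a.2) * y.1).
Proof.
case: x y => [x1 x2] [y1 y2]; rewrite /orient /= /GRing.scale /=; ring.
Qed.

(** The coordinates of [x - a] in the basis formed by the two sides that meet
    at [a], by Cramer's rule. *)
Lemma orient_cramer a b c x : orient c a b != 0 ->
  x = a + (orient c a x / orient c a b) *: (b - a)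
        - (orient a b x / orient c a b) *: (a - c).
Proof.
case: a b c x => [a1 a2] [b1 b2] [c1 c2] [x1 x2]; rewrite /orient /= => D0.
by congr pair; rewrite /= /GRing.scale /=; field.
Qed.

Lemma orient_continuous a b : continuous (orient a b : plane R -> R^o).
Proof.
move=> x; rewrite /orient.
apply: cvgB; apply: cvgM; try exact: cvg_cst;
  (apply: cvgB; last exact: cvg_cst); [exact: cvg_snd | exact: cvg_fst].
Qed.

End Orient.

Lemma ordS_neq n (i : 'I_n) : (2 <= n)%N -> ordS i != i.
Proof.
move=> n2; apply/negP => /eqP/(congr1 val) /=; have lin := ltn_ord i.
case: (ltnP i.+1 n) => [h|h]; first by rewrite modn_small //; lia.
by rewrite (_ : i.+1 = n :> nat); [rewrite modnn; lia | lia].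
Qed.

Lemma ordSS_neq n (i : 'I_n) : (3 <= n)%N -> ordS (ordS i) != i.
Proof.
move=> n3; apply/negP => /eqP/(congr1 val) /=; have lin := ltn_ord i.
case: (ltnP i.+1 n) => [h|h].
  rewrite (modn_small h); case: (ltnP i.+2 n) => h'.
    by rewrite modn_small //; lia.
  by rewrite (_ : i.+2 = n :> nat); [rewrite modnn; lia | lia].
rewrite (_ : i.+1 = n :> nat); last lia.
by rewrite modnn modn_small; lia.
Qed.

Lemma ordS_ind n (Q : 'I_n -> Prop) : (forall i, Q (ordS i)) -> forall i, Q i.
Proof. by move=> QS i; rewrite -(ord_predK i). Qed.

(** * Strictly convex polygons *)

Section StrictlyConvex.
Variables (R : realType) (n : nat) (P : 'I_n -> plane R).
Hypothesis n3 : (3 <= n)%N.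
Hypothesis convP : @strictly_convex R n P.
Local Notation side i := (@orient R (P i) (P (ordS i))).

Definition left_region : set (plane R) := [set x | forall i, 0 < side i x].

Lemma side_ge0 i j : 0 <= side i (P j).
Proof.
have [->|ji] := eqVneq j i; first by rewrite orient_left.
have [->|jsi] := eqVneq j (ordS i); first by rewrite orient_right.
exact/ltW/convP.
Qed.

Lemma side_next i : 0 < side i (P (ordS (ordS i))).
Proof.
by apply: convP; [exact: ordSS_neq | apply: ordS_neq; exact: ltnW].
Qed.

Lemma side_edge0 i x : edge P i x -> side i x = 0.
Proof.
by move=> [t _ <-]; rewrite orient_conv orient_left orient_right !mulr0 addr0.
Qed.

Lemma side_edge_ge0 i j x : edge P j x -> 0 <= side i x.
Proof.
move=> [t /=]; rewrite in_itv /= => /andP[t0 t1] <-; rewrite orient_conv.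
by apply: addr_ge0; apply: mulr_ge0; first [exact: side_ge0 | rewrite ?subr_ge0].
Qed.

Lemma edge_vertex i : edge P i (P i).
Proof.
by exists 0; rewrite /= ?in_itv /= ?lexx ?ler01 // subr0 scale1r scale0r addr0.
Qed.

Lemma edge_vertexS i : edge P i (P (ordS i)).
Proof.
by exists 1; rewrite /= ?in_itv /= ?lexx ?ler01 // subrr scale1r scale0r add0r.
Qed.

(** On the line of the side [i], the two neighbouring sides already delimit the
    edge: by Cramer's rule the parameter of [x] on this line is, up to positive
    factors, the orientation of [x] with respect to side [i - 1], and its
    complement to 1 the orientation with respect to side [i + 1]. *)
Lemma edge_side0 i x : (forall j, 0 <= side j x) -> side i x = 0 -> edge P i x.
Proof.
elim/ordS_ind: i => h ge0 x0.
set i := ordS h in x0 *.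
have D0 : 0 < side h (P (ordS i)) by exact: side_next.
set t := side h x / side h (P (ordS i)).
have xE : x = (1 - t) *: P i + t *: P (ordS i).
  rewrite [LHS](@orient_cramer _ (P i) (P (ordS i)) (P h)) ?gt_eqF //.
  rewrite x0 mul0r scale0r subr0 scalerBr scalerBl scale1r.
  by rewrite -addrA [X in _ + X]addrC.
exists t => //=; rewrite in_itv /= divr_ge0 //= ?(ltW D0) //.
have := ge0 (ordS i); rewrite [x in side _ x]xE orient_conv orient_left mulr0 addr0.
by rewrite pmulr_lge0 ?subr_ge0 // orient_rot; exact: side_next.
Qed.

Lemma injective_vertices : injective P.
Proof.
move=> i j Pij; apply/eqP; rewrite eq_sym; apply/negPn/negP => ji.
have [jsi|jsi] := eqVneq j (ordS i).
  have := side_next i; rewrite -jsi -Pij.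
  by rewrite orient_rot orient_right ltxx.
by have := convP ji jsi; rewrite -Pij orient_left ltxx.
Qed.

Lemma edgeI_next i x : edge P i x -> edge P (ordS i) x -> x = P (ordS i).
Proof.
move=> /side_edge0 xi [t _ xE]; move: xi; rewrite -{}xE orient_conv orient_right.
rewrite mulr0 add0r => /eqP; rewrite mulf_eq0 (gt_eqF (side_next i)) orbF.
by move=> /eqP ->; rewrite subr0 scale0r addr0 scale1r.
Qed.

Lemma strictly_convex_simple : simple_polygon P.
Proof.
split => //; first exact: injective_vertices.
move=> i j ij; case: eqP => [->|/eqP jsi].
  apply/seteqP; split=> [x [xi xj]|x ->]; first exact: edgeI_next.
  by split; [exact: edge_vertexS | exact: edge_vertex].
case: eqP => [->|/eqP isj].
  apply/seteqP; split=> [x [xi xj]|x ->]; first exact: edgeI_next.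
  by split; [exact: edge_vertex | exact: edge_vertexS].
apply/seteqP; split=> [x [/side_edge0 xi xj]|x //].
have {xj} [t /=] := xj; rewrite in_itv /= => /andP[t0 t1] xE.
move: xi; rewrite -xE orient_conv.
(* Both ends of the edge [j] are strictly to the left of the side [i]. *)
have pj : 0 < side i (P j) by apply: convP => //; rewrite eq_sym.
have psj : 0 < side i (P (ordS j)).
  by apply: convP; [rewrite eq_sym | rewrite (inj_eq (@ordS_inj _)) eq_sym].
nra.
Qed.

Lemma left_region_not_boundary x : left_region x -> ~ poly_boundary P x.
Proof. by move=> px [i _ /side_edge0 x0]; have := px i; rewrite x0 ltxx. Qed.

Lemma left_region_closure x : ~ poly_boundary P x ->
  (forall i, 0 <= side i x) -> left_region x.
Proof.
move=> nbx ge0 i; rewrite lt_neqAle ge0 andbT eq_sym; apply/eqP => x0.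
by apply: nbx; exists i => //; exact: edge_side0.
Qed.

Lemma open_sides (D : pred 'I_n) : open [set x | forall i, D i -> 0 < side i x].
Proof.
rewrite openE => x px.
suff : \forall y \near x, forall i, D i -> 0 < side i y by [].
apply: (@filter_forall _ _ (fun i y => D i -> 0 < side i y) (nbhs x)
  (nbhs_filter x)) => i.
have [Di|nDi] := boolP (D i); last by apply: nearW => y.
have : open ((side i : plane R -> R^o) @^-1` [set z : R^o | 0 < z]).
  by apply: open_comp => [y _|]; [exact: orient_continuous | exact: open_gt].
by rewrite openE => /(_ x (px i Di)); apply: filterS.
Qed.

Lemma closed_sides : closed [set x | forall i, 0 <= side i x].
Proof.
rewrite (_ : [set x | _] =
  \bigcap_i ((side i : plane R -> R^o) @^-1` [set z : R^o | 0 <= z])); last first.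
  by apply/seteqP; split=> [x px i _|x px i]; exact: px.
apply: closed_bigI => i _; apply: closed_comp => [y _|]; last exact: closed_ge.
exact: orient_continuous.
Qed.

(** In a component of the complement of the boundary, the open and the closed
    half-planes define the same subset, which is therefore both open and closed
    in this component. *)
Lemma component_left_region x : left_region x ->
  connected_component (~` poly_boundary P) x `<=` left_region.
Proof.
move=> px; set C := connected_component _ x.
have Cx : C x by apply: connected_component_refl; exact: left_region_not_boundary.
have : C `&` left_region = C.
  apply: component_connected; first by exists x.
    exists left_region => //.
    rewrite (_ : left_region = [set x | forall i, xpredT i -> 0 < side i x]).
      exact: open_sides.
    by apply/seteqP; split=> y py i; [move=> _; exact: py | exact: py].
  exists [set x | forall i, 0 <= side i x]; first exact: closed_sides.
  apply/seteqP; split=> y [Cy py]; split=> //.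
    by move=> i; exact/ltW/py.
  apply: left_region_closure => //.
  exact: (connected_component_sub Cy).
by move=> <- y [].
Qed.

(** The linear part of the sum is the determinant with the sum of the side
    vectors, which vanishes because the polygon closes up. *)
Lemma sum_side x y : \sum_i side i x = \sum_i side i y.
Proof.
have E (f : 'I_n -> R) : \sum_i (f (ordS i) - f i) = 0.
  rewrite sumrB [X in X - _](_ : _ = \sum_i f i) ?subrr //.
  by rewrite [RHS](reindex_inj (@ordS_inj _)).
apply/eqP; rewrite -subr_eq0 -sumrB.
rewrite (eq_bigr (fun i => ((P (ordS i)).1 - (P i).1) * (x.2 - y.2) -
  ((P (ordS i)).2 - (P i).2) * (x.1 - y.1))); last first.
  by move=> i _; rewrite /orient; ring.
by rewrite sumrB -!mulr_suml (E (fun i => (P i).1)) (E (fun i => (P i).2)) !mul0r subr0.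
Qed.

(** All the orientations are positive and have a constant sum [S], so each of
    them is at most [S]; two of them, for adjacent sides, are coordinates of the
    plane. *)
Lemma bounded_left_region : bounded_set left_region.
Proof.
have i0 : 'I_n by exact: (Ordinal (ltnW (ltnW n3))).
set S := \sum_i side i (P i0).
have lS x i : left_region x -> side i x <= S.
  move=> px; rewrite /S (sum_side _ x) (bigD1 i) //= lerDl.
  by apply: sumr_ge0 => j _; exact/ltW/px.
set h := i0; set i := ordS h; set D := side h (P (ordS i)).
have D0 : 0 < D by exact: side_next.
exists (`|P i| + (S / D) * `|P (ordS i) - P i| + (S / D) * `|P i - P h|).
split=> [|M BM x px /=]; first exact: num_real.
apply: le_trans (ltW BM).
have ler_quot j : `|side j x / D| <= S / D.
  have xj : 0 <= side j x by exact/ltW/px.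
  rewrite ger0_norm; last exact: divr_ge0 xj (ltW D0).
  by rewrite ler_pM2r ?invr_gt0 //; exact: lS.
rewrite {1}(@orient_cramer _ (P i) (P (ordS i)) (P h) x) ?gt_eqF //.
rewrite (le_trans (ler_normB _ _)) // lerD //; last first.
  by rewrite normrZ ler_wpM2r //; exact: ler_quot.
rewrite (le_trans (ler_normD _ _)) // lerD //.
by rewrite normrZ ler_wpM2r //; exact: ler_quot.
Qed.

(** From [x] one can go to infinity along the outer normal [v] of the side [i],
    staying in the open half-plane to its right, which the polygon does not
    meet. *)
Lemma outside_unbounded i x : side i x < 0 ->
  ~ bounded_set (connected_component (~` poly_boundary P) x).
Proof.
move=> xi bC.
set a := P i; set b := P (ordS i).
pose v : plane R := (b.2 - a.2, a.1 - b.1).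
pose path (s : R^o) : plane R := x + s *: v.
have out s : 0 <= s -> side i (path s) < 0.
  move=> s0; rewrite /path orient_shift /= -/a -/b.
  rewrite [X in s * X](_ : _ = - ((b.1 - a.1) ^+ 2 + (b.2 - a.2) ^+ 2)); last ring.
  rewrite mulrN subr_lt0 (lt_le_trans xi) // mulr_ge0 //.
  by rewrite addr_ge0 // sqr_ge0.
have pathC s : 0 <= s -> connected_component (~` poly_boundary P) x (path s).
  move=> s0.
  apply: (@connected_component_max _ _ (path @` `[0, s])).
  - by exists 0; rewrite /= ?in_itv /= ?lexx // /path scale0r addr0.
  - move=> _ [t /= + <-]; rewrite in_itv /= => /andP[t0 _] [j _ tj].
    by have := side_edge_ge0 i tj; rewrite leNgt out.
  - apply: connected_continuous_connected; first exact: segment_connected.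
    apply: continuous_subspaceT => t.
    by apply: cvgD; [exact: cvg_cst | apply: cvgZ; [exact: cvg_id | exact: cvg_cst]].
  - by exists s; rewrite //= in_itv /= s0 lexx.
have v0 : 0 < `|v|.
  rewrite normr_gt0; apply/eqP => -[/eqP + /eqP].
  rewrite !subr_eq0 => /eqP b2 /eqP b1.
  have : P i = P (ordS i).
    by rewrite [LHS]surjective_pairing [RHS]surjective_pairing -/a -/b b1 b2.
  by move=> /injective_vertices/esym/eqP; rewrite (negbTE (ordS_neq _ (ltnW n3))).
have [M [_ /(_ (M + 1))]] := bC; rewrite ltrDl ltr01 => /(_ isT) MC.
pose s := (`|M| + 2 + `|x|) / `|v|.
have s0 : 0 <= s by rewrite divr_ge0 // !addr_ge0.
have := MC _ (pathC s s0); rewrite /path /=.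
have := ler_normB (x + s *: v) x.
rewrite addrC addKr normrZ (ger0_norm s0) divfK ?gt_eqF //.
have := ler_norm M; lra.
Qed.

Lemma poly_interiorE : poly_interior P = left_region.
Proof.
apply/seteqP; split=> [x [nbx bx]|x px].
  apply: left_region_closure => // i; rewrite leNgt; apply/negP => xi.
  exact: (outside_unbounded xi).
split; first exact: left_region_not_boundary.
have [M [Mreal MR]] := bounded_left_region.
exists M; split=> // N MN y Cy.
exact: (MR N MN y (component_left_region px Cy)).
Qed.

End StrictlyConvex.

(** * Interior angles *)

Section Angles.
Variable R : realType.
Implicit Types x y t : R.

Lemma polar_upper x y : 0 < y ->
  exists rho t, [/\ 0 < rho, 0 < t < pi, x = rho * cos t & y = rho * sin t].
Proof.
move=> y0; set rho := Num.sqrt (x ^+ 2 + y ^+ 2).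
have s0 : 0 < x ^+ 2 + y ^+ 2 by rewrite ltr_wpDl ?sqr_ge0 // exprn_gt0.
have rho0 : 0 < rho by rewrite sqrtr_gt0.
have rho2 : rho ^+ 2 = x ^+ 2 + y ^+ 2 by rewrite sqr_sqrtr // ltW.
have xrho : -1 < x / rho < 1.
  rewrite -ltr_norml normrM normfV (gtr0_norm rho0) ltr_pdivrMr // mul1r.
  by rewrite -sqrtr_sqr ltr_sqrt // ltrDl exprn_gt0.
have /andP[l1 l2] := xrho.
have xrho' : -1 <= x / rho <= 1 by rewrite !ltW.
exists rho, (acos (x / rho)); split => //.
- by rewrite acos_gt0 ?acos_ltpi // ?l1 ?l2 ?ltW.
- by rewrite acosK ?in_itv //= mulrC divfK ?gt_eqF.
- rewrite sin_acos // [_ ^+ 2]expr_div_n rho2.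
  have -> : 1 - x ^+ 2 / (x ^+ 2 + y ^+ 2) = (y / rho) ^+ 2.
    by rewrite expr_div_n rho2; field; rewrite gt_eqF.
  rewrite sqrtr_sqr ger0_norm ?divr_ge0 ?ltW //.
  by rewrite mulrC divfK ?gt_eqF.
Qed.

Lemma polar x y : (x != 0) || (y != 0) ->
  exists rho t, [/\ 0 < rho, x = rho * cos t & y = rho * sin t].
Proof.
move=> xy0; have [y0|y0|y0] := ltgtP y 0.
- have [|rho [t [r0 _ xE yE]]] := @polar_upper (- x) (- y).
    by rewrite oppr_gt0.
  exists rho, (t + pi); split => //; rewrite ?sinDpi ?cosDpi mulrN -?xE -?yE opprK //.
- by have [rho [t [r0 _ xE yE]]] := @polar_upper x y y0; exists rho, t.
- move: xy0; rewrite y0 eqxx orbF => x0.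
  have [x1|x1|x1] := ltgtP x 0; last by rewrite x1 eqxx in x0.
    exists (- x), pi; rewrite oppr_gt0 cospi sinpi mulrN1 opprK mulr0; split => //.
  by exists x, 0; rewrite cos0 sin0 mulr1 mulr0; split.
Qed.

(** With [theta < pi], a sector is the intersection of two half-planes. *)
Lemma sin_sector (theta phi : R) : 0 < theta < pi -> 0 <= phi < 2 * pi ->
  (0 < phi < theta) = (0 < sin phi) && (0 < sin (theta - phi)).
Proof.
move=> /andP[t0 tpi] /andP[p0 p2].
apply/idP/idP => [/andP[lp lt]|/andP[sp st]].
  by rewrite !sin_gt0_pi //; apply/andP; split; lra.
have phipi : phi < pi.
  rewrite ltNge; apply/negP => pip; move: sp; rewrite -[phi](subrK pi) sinDpi.
  rewrite oppr_gt0 ltNge => /negP; apply; apply: sin_ge0_pi.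
  by apply/andP; split; lra.
have phi0 : 0 < phi.
  by rewrite lt_neqAle p0 andbT; apply/eqP => p; move: sp; rewrite -p sin0 ltxx.
rewrite phi0 /= ltNge; apply/negP => tp; move: st; rewrite -opprB sinN oppr_gt0.
rewrite ltNge => /negP; apply; apply: sin_ge0_pi.
by apply/andP; split; lra.
Qed.

End Angles.

Section ConvexAngles.
Variables (R : realType) (n : nat) (P : 'I_n -> plane R).
Hypothesis n3 : (3 <= n)%N.
Hypothesis convP : @strictly_convex R n P.

(** Put the polar axis along the side that leaves [P i], in direction [alpha]; the
    reversed incoming side then has the direction [alpha + theta] with
    [0 < theta < pi], since the next vertex and the previous one turn
    counterclockwise around [P i].  Close to [P i] only these two sides matter,
    and in polar coordinates their orientations are positive multiples of
    [sin phi] and [sin (theta - phi)]. *)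
Lemma strictly_convex_angles : convex_polygon P.
Proof.
elim/ordS_ind => h; set i := ordS h.
set a := P i; set b := P (ordS i); set c := P h.
have det0 : 0 < @orient R a b c by rewrite orient_rot; exact: side_next.
have [rho [alpha [rho0 d1 d2]]] :
    exists rho t, [/\ 0 < rho, b.1 - a.1 = rho * cos t & b.2 - a.2 = rho * sin t].
  apply: polar; rewrite -negb_and; apply/negP => /andP[/eqP d1 /eqP d2].
  by move: det0; rewrite /orient d1 d2 !mul0r subrr ltxx.
(* The incoming side, reversed, in the frame rotated by [alpha]. *)
have y0 : 0 < cos alpha * (c.2 - a.2) - sin alpha * (c.1 - a.1).
  rewrite -(pmulr_rgt0 _ rho0); move: det0; rewrite /orient d1 d2.
  by congr (0 < _); ring.
have [rho' [theta [rho'0 thetapi xE yE]]] :=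
  polar_upper (cos alpha * (c.1 - a.1) + sin alpha * (c.2 - a.2)) y0.
have cs := cos2Dsin2 alpha.
have e1 : c.1 - a.1 = rho' * cos (alpha + theta).
  rewrite cosD mulrBr mulrCA -xE [rho' * (_ * sin theta)]mulrCA -yE.
  by rewrite -[LHS]mul1r -cs; ring.
have e2 : c.2 - a.2 = rho' * sin (alpha + theta).
  rewrite sinD mulrDr mulrCA -xE [rho' * (_ * sin theta)]mulrCA -yE.
  by rewrite -[LHS]mul1r -cs; ring.
have /andP[theta0 thetaltpi] := thetapi.
exists theta => //; split; first by rewrite theta0 /=; lra.
pose D j := (j != i) && (j != h).
have near_a : [set x | forall j, D j -> 0 < @orient R (P j) (P (ordS j)) x] a.
  move=> j /andP[ji jh]; apply: convP; first by rewrite eq_sym.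
  by rewrite (inj_eq (@ordS_inj _)) eq_sym.
have [e /= e0 ball_e] :=
  (nbhs_ballP _ _).1 (open_nbhs_nbhs (conj (@open_sides R n P D) near_a)).
exists alpha, e; split => // r phi /andP[r0 re] phiI.
set u := (cos (alpha + phi), sin (alpha + phi)) : plane R.
have side_i : @orient R a b (a + r *: u) = r * rho * sin phi.
  have -> : sin phi = sin ((alpha + phi) - alpha) by congr sin; ring.
  rewrite orient_shift orient_left add0r d1 d2 /= sinB; ring.
have side_h : @orient R c a (a + r *: u) = r * rho' * sin (theta - phi).
  have -> : sin (theta - phi) = sin ((alpha + theta) - (alpha + phi)).
    by congr sin; ring.
  rewrite orient_shift orient_right add0r -(opprB c.1) -(opprB c.2) e1 e2 sinB /=.
  ring.
rewrite poly_interiorE // sin_sector //; split=> [px|/andP[sphi sth] j].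
  have := px i; rewrite side_i !pmulr_rgt0 ?mulr_gt0 // => -> /=.
  by have := px h; rewrite side_h !pmulr_rgt0 ?mulr_gt0.
have [->|ji] := eqVneq j i; first by rewrite side_i !mulr_gt0.
have [->|jh] := eqVneq j h; first by rewrite side_h !mulr_gt0.
apply: ball_e; last by rewrite /D ji jh.
have small (z : R) : `|z| <= 1 -> `|r * z| < e.
  move=> z1; rewrite normrM (gtr0_norm r0) (le_lt_trans _ re) //.
  by rewrite ler_piMr // ltW.
split; rewrite /ball /= opprD addrA subrr add0r normrN; apply: small.
  by rewrite ler_norml cos_geN1 cos_le1.
by rewrite ler_norml sin_geN1 sin_le1.
Qed.

End ConvexAngles.

(** * Lattice polygons *)

Section Lattice.
Variables (R : realType) (n : nat) (V : 'I_n -> int * int).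

Definition lattice_embed (v : int * int) : plane R := (v.1%:~R, v.2%:~R).

Lemma lattice_embed_inj : injective lattice_embed.
Proof. by move=> [a b] [c d] [/intr_inj -> /intr_inj ->]. Qed.

Lemma orient_lattice_embed a b x :
  @orient R (lattice_embed a) (lattice_embed b) (lattice_embed x) =
  (orient a b x)%:~R.
Proof. by rewrite /orient /= -!intrB -!intrM -intrB. Qed.

Lemma strictly_convex_lattice :
  strictly_convex V -> @strictly_convex R n (lattice_embed \o V).
Proof. by move=> cV i j ji jsi; rewrite /= orient_lattice_embed ltr0z cV. Qed.

(** By Bezout, the parameter of a lattice point on such a segment is an integral
    combination of integers, hence an integer of [[0, 1]]. *)
Lemma primitive_segment (a b x : int * int) : coprimez (b.1 - a.1) (b.2 - a.2) ->
  segment (lattice_embed a) (lattice_embed b) (lattice_embed x) ->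
  x = a \/ x = b.
Proof.
move=> /coprimezP[[u v] /= uv] [t /=]; rewrite in_itv /= => /andP[t0 t1].
move=> [x1 x2].
set m := u * (x.1 - a.1) + v * (x.2 - a.2).
have tm : t = m%:~R.
  rewrite /m intrD !intrM !intrB -x1 -x2 /GRing.scale /=.
  have := congr1 (fun z : int => z%:~R : R) uv; rewrite intrD !intrM !intrB => uvR.
  rewrite -[LHS]mulr1 -[1 in LHS]uvR; ring.
move: t0 t1; rewrite tm ler0z -[1]/(1%:~R) ler_int => m0 m1.
have [m_0|m_1] : m = 0 \/ m = 1 by lia.
  left; apply: lattice_embed_inj.
  rewrite /lattice_embed -x1 -x2 tm m_0.
  by rewrite !subr0 !scale1r !scale0r !addr0.
right; apply: lattice_embed_inj.
rewrite /lattice_embed -x1 -x2 tm m_1.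
by rewrite !subrr !scale1r !scale0r !add0r.
Qed.

Lemma boundary_lattice_primitive :
  (forall i, coprimez ((V (ordS i)).1 - (V i).1) ((V (ordS i)).2 - (V i).2)) ->
  boundary_lattice_points (lattice_embed \o V) = range (lattice_embed \o V).
Proof.
move=> prim; apply/seteqP; split=> [_ [[a [b ->]] [i _ ei]]|_ [i _ <-]].
  have [xE|xE] := @primitive_segment _ _ (a, b) (prim i) ei.
    by exists i => //=; rewrite -xE.
  by exists (ordS i) => //=; rewrite -xE.
split; first by exists (V i).1, (V i).2.
by exists i => //; exact: edge_vertex.
Qed.

Lemma interior_lattice_convex : (3 <= n)%N -> strictly_convex V ->
  interior_lattice_points (lattice_embed \o V) =
  lattice_embed @` [set x | forall i, 0 < orient (V i) (V (ordS i)) x].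
Proof.
move=> n3 cV; rewrite /interior_lattice_points poly_interiorE //; last first.
  exact: strictly_convex_lattice.
apply/seteqP; split=> [_ [[a [b ->]] px]|_ [x px <-]].
  exists (a, b) => // i.
  by have := px i; rewrite -[(_, _)]/(lattice_embed (a, b)) orient_lattice_embed ltr0z.
split; first by exists x.1, x.2.
by move=> i; rewrite orient_lattice_embed ltr0z.
Qed.

End Lattice.

(** * The family of polygons *)

Section Family.

(** The hexagon for [n = 6]; the two [nseq] drop the vertex (2p - q - 1, 0) for
    [n = 5], and also (0, 2) for [n = 4]. *)
Definition vertices (p q : nat) (n : nat) : seq (int * int) :=
  [:: (2 * p%:Z - q%:Z, 0); (q%:Z + 1, 2); (1, 3)] ++ nseq (4 < n) (0, 2) ++
  [:: (0, 1)] ++ nseq (5 < n) (2 * p%:Z - q%:Z - 1, 0).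

Definition family p q n (i : 'I_n) : int * int := nth (0, 0) (vertices p q n) i.

Variables p q n : nat.
Hypothesis (q_gt0 : (0 < q)%N) (pq : (q <= p <= q.+1)%N) (pq3 : (3 <= p + q)%N).
Hypothesis hn : n \in [:: 4; 5; 6]%N.

Lemma family_convex : strictly_convex (@family p q n).
Proof.
move: hn; rewrite !inE => /or3P[] /eqP ->;
  move=> [[|[|[|[|[|[|i]]]]]] hi] // [[|[|[|[|[|[|j]]]]]] hj] //;
  rewrite /orient /family /=; lia.
Qed.

Lemma family_primitive (i : 'I_n) : coprimez
  ((family p q (ordS i)).1 - (family p q i).1)
  ((family p q (ordS i)).2 - (family p q i).2).
Proof.
(* Bezout coefficients for the side number [i].  The list serves the three
   values of [n]: from number 2 on, all sides but the horizontal one of the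
   hexagon have a difference of coordinates equal to -1, and these differences
   come in the same places. *)
apply/coprimezP; exists (nth (0, 0)
  [:: (1, p%:Z - q%:Z); (0, 1); (-1, 0); (0, -1); (0, -1); (1, 0)] i).
move: i; move: hn; rewrite !inE => /or3P[] /eqP ->;
  move=> [[|[|[|[|[|[|i]]]]]] hi] //; rewrite /family /=; lia.
Qed.

(** The quadrilateral is contained in the pentagon and in the hexagon, so the
    matter is to show that an interior lattice point of these is also interior
    to the quadrilateral.  Its two additional sides cut off triangles of minimal
    area: the orientation with respect to such a side, increased by 1, is the sum
    of the (positive integral) orientations with respect to the two sides that
    it replaces. *)
Lemma family_interior (x y : int) :
  (forall i : 'I_n, 0 < orient (family p q i) (family p q (ordS i)) (x, y)) <->
  (y = 1 /\ 1 <= x <= p%:Z) \/ (y = 2 /\ 1 <= x <= q%:Z).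
Proof.
split=> [H|H].
  have [H0 H1 H2 H3] : [/\ 0 < orient (2 * p%:Z - q%:Z, 0) (q%:Z + 1, 2) (x, y),
     0 < orient (q%:Z + 1, 2) (1, 3) (x, y),
     0 < orient (1, 3) (0, 1) (x, y) &
     0 < orient (0, 1) (2 * p%:Z - q%:Z, 0) (x, y)].
    move: H; move: hn; rewrite !inE => /or3P[] /eqP -> H.
    - by split; [have := H (@Ordinal 4 0 isT) | have := H (@Ordinal 4 1 isT)
               | have := H (@Ordinal 4 2 isT) | have := H (@Ordinal 4 3 isT)].
    - have := H (@Ordinal 5 2 isT); have := H (@Ordinal 5 3 isT).
      rewrite /orient /family /= => h3 h2.
      by split; [have := H (@Ordinal 5 0 isT) | have := H (@Ordinal 5 1 isT)
               | lia | have := H (@Ordinal 5 4 isT)].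
    - have := H (@Ordinal 6 2 isT); have := H (@Ordinal 6 3 isT).
      have := H (@Ordinal 6 4 isT); have := H (@Ordinal 6 5 isT).
      rewrite /orient /family /= => h5 h4 h3 h2.
      by split; [have := H (@Ordinal 6 0 isT) | have := H (@Ordinal 6 1 isT)
               | lia | lia].
  move: H0 H1 H2 H3; rewrite /orient /= => H0 H1 H2 H3.
  (* Sides 0 and 3 meet in the lowest vertex and force [0 < y]; sides 1 and 2
     meet in the highest one and force [y < 3]. *)
  have yI : 1 <= y <= 2.
    have [pE|pE] : p = q \/ p = q.+1 by lia.
      by rewrite pE in H0 H3; nia.
    by rewrite pE in H0 H3; nia.
  have [yE|yE] : y = 1 \/ y = 2 by lia.
    by left; split=> //; rewrite yE in H0 H3; lia.
  by right; split=> //; rewrite yE in H1 H2; lia.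
move: hn H; rewrite !inE => /or3P[] /eqP -> H;
  move=> [[|[|[|[|[|[|i]]]]]] hi] //;
  rewrite /orient /family /=; nia.
Qed.

End Family.

Theorem theorem9 (R : realType) (k n : nat) (hk : (3 <= k)%N)
    (hn : n \in [:: 4; 5; 6]%N) :
  exists P : 'I_n -> plane R,
    [/\ lattice_polygon P,
        convex_polygon P,
        boundary_lattice_points P #= `I_n,
        interior_lattice_points P #= `I_k &
        ~ collinear (interior_lattice_points P)].
Proof.
have n3 : (3 <= n)%N by move: hn; rewrite !inE => /or3P[] /eqP ->.
pose q := k./2; pose p := (k - q)%N.
have q_gt0 : (0 < q)%N by rewrite /q; lia.
have pq : (q <= p <= q.+1)%N by rewrite /p /q; lia.
have pqk : (p + q)%N = k by rewrite /p /q; lia.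
have pq3 : (3 <= p + q)%N by rewrite pqk.
have cV := family_convex q_gt0 pq pq3 hn.
have cP := strictly_convex_lattice R cV.
have intE := interior_lattice_convex R n3 cV.
exists (lattice_embed R \o family p q (n := n)); split.
- split; first exact: strictly_convex_simple.
  by move=> i; exists (family p q i).1, (family p q i).2.
- exact: strictly_convex_angles.
- rewrite boundary_lattice_primitive; last exact: family_primitive.
  apply: card_eq_trans (card_esym card_II); apply: inj_card_eq => i j _ _.
  exact: (injective_vertices n3 cP).
- pose f i : int * int := if (i < p)%N then (i.+1%:Z, 1) else ((i - p).+1%:Z, 2).
  rewrite intE.
  rewrite (_ : [set x | _] = f @` `I_k); last first.
    apply/seteqP; split=> [[x y] /= /(family_interior q_gt0 pq pq3 hn)|].
      case=> -[-> xI].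
        exists `|x - 1|%N; first by rewrite /=; lia.
        by rewrite /f (_ : (_ < _)%N = true); [congr pair; lia | lia].
      exists (p + `|x - 1|)%N; first by rewrite /=; lia.
      by rewrite /f (_ : (_ < _)%N = false); [congr pair; lia | lia].
    move=> _ [i /= ik <-]; rewrite /f.
    by case: ifP => ip; apply/family_interior => //; [left|right]; split => //; lia.
  rewrite image_comp; apply: inj_card_eq => i j _ _ /lattice_embed_inj.
  by rewrite /f; case: ifP => ip; case: ifP => jp [] //; lia.
move=> [a0 [d [_ sub]]].
have on_line x y : y = 1 /\ 1 <= x <= p%:Z \/ y = 2 /\ 1 <= x <= q%:Z ->
    exists t : R, lattice_embed R (x, y) = a0 + t *: d.
  move=> xy; have [t _ tE] : range (fun t : R => a0 + t *: d) (lattice_embed R (x, y)).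
    apply: sub; rewrite intE; exists (x, y) => //.
    exact/(family_interior q_gt0 pq pq3 hn).
  by exists t.
have [|t1 [x1 y1]] := on_line 1 1; first by left; lia.
have [|t2 [x2 y2]] := on_line 2 1; first by left; lia.
have [|t3 [x3 y3]] := on_line 1 2; first by right; lia.
(* A line through (1, 1) and (2, 1) is horizontal, so it misses (1, 2). *)
have tx : (t2 - t1) * d.1 = 1 by move: x1 x2; rewrite /GRing.scale /=; lra.
have ty : (t2 - t1) * d.2 = 0 by move: y1 y2; rewrite /GRing.scale /=; lra.
have d2 : d.2 = 0 by rewrite -[LHS]mul1r -tx mulrAC ty mul0r.
by move: y1 y3; rewrite /GRing.scale /= d2 !mulr0; lra.
Qed.
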